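(* Consider $n$ independent flips of a fair coin, scored by Alice and Bob as described in the context. Then: (a) For every $n\ge 3$, Bob is strictly more likely than Alice to win, that is, $\mathbb{P}(\text{Bob wins after } n \text{ flips})>\mathbb{P}(\text{Alice wins after } n\text{ flips})$. (b) $\mathbb{P}(\text{Bob wins after } n\text{ flips})-\mathbb{P}(\text{Alice wins after } n\text{ flips})\sim c/\sqrt n$ as $n\to\infty$, where $c=\dfrac{1}{2\sqrt{\pi}}$. (c) The probability of a tie after $n$ flips is asymptotic to $1/\sqrt{\pi n}$ as $n\to\infty$.
   Context: A fair coin is tossed $n$ times, with independent outcomes $\omega_1,\dots,\omega_n\in\{H,T\}$, each equal to $H$ (head) or $T$ (tail) with probability $\frac12$. Alice's score is the number of indices $1\le i\le n-1$ with $\omega_i\omega_{i+1}=HH$ (overlapping appearances are all counted). Bob's score is the number of indices $1\le i\le n-1$ with $\omega_i\omega_{i+1}=HT$. The winner after $n$ flips is the player with the strictly larger score; a tie occurs when the scores are equal. The notation $a_n\sim b_n$ means $a_n/b_n\to 1$ as $n\to\infty$. *)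

(* Defs.v *)
From mathcomp Require Import all_boot all_order all_algebra.
From mathcomp Require Import all_classical all_reals all_analysis.
Import Order.TTheory GRing.Theory Num.Theory.
Import numFieldNormedType.Exports.

Set Implicit Arguments.
Unset Strict Implicit.
Unset Printing Implicit Defensive.

Local Open Scope classical_set_scope.
Local Open Scope ring_scope.

Notation coin := bool.
Definition heads : coin := true.
Definition tails : coin := false.

(* Independence of the flips is the product form of the weight of each
   sequence w, every factor being the law of one fair coin. *)
Definition flips_prob (R : realType) (n : nat) (E : {set n.-tuple coin}) : R :=
  \sum_(w in E) \prod_(i < n) bernoulli_pmf (2^-1 : R) (tnth w i).

(* Positions are 0-based: i < n.-1 stands for the index i + 1 in 1 .. n - 1.
   Both i and i.+1 are then < n, so the default value of nth is never used. *)
Definition score (n : nat) (a b : coin) (w : n.-tuple coin) : nat :=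
  #|[pred i : 'I_n.-1 | (nth tails w i == a) && (nth tails w i.+1 == b)]|.

Definition alice_score (n : nat) (w : n.-tuple coin) : nat := score heads heads w.
Definition bob_score (n : nat) (w : n.-tuple coin) : nat := score heads tails w.

Definition alice_wins (n : nat) : {set n.-tuple coin} :=
  [set w | (bob_score w < alice_score w)%N].
Definition bob_wins (n : nat) : {set n.-tuple coin} :=
  [set w | (alice_score w < bob_score w)%N].
Definition tie (n : nat) : {set n.-tuple coin} :=
  [set w | alice_score w == bob_score w].

Definition asymp (R : realType) (u v : nat -> R) : Prop :=
  (fun n => u n / v n) @ \oo --> (1 : R).

(* Main.v *)
(* Put s n = \sum_k 'C(2 k, k) 'C(n - 2 k, k). Counting words by their two scores
   and their last letter shows that Bob wins on exactly (s n - 1) / 2 more words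
   of length n than Alice, and that (s n.+1 + 1) / 2 + s n words of length n.+1
   are ties. This gives (a), as s n > 1 for n >= 3; (b) and (c) follow from
   s n / 2 ^ n ~ 1 / sqrt (pi n), which is a law of large numbers: s n / 2 ^ n is
   the expectation of 'C(2 k, k) / 4 ^ k ~ 1 / sqrt (pi k) over the visits to n of
   a walk with steps 1 and 3 of probability 1/2 each, k being the number of steps
   of length 3. The mean step being 2, the walk visits n with probability tending
   to 1/2, after about n / 4 steps of length 3. *)
Require Import Defs.
From mathcomp Require Import all_boot all_order all_algebra.
From mathcomp Require Import all_classical all_reals all_analysis.
From mathcomp Require Import zify ring lra.
Import Order.TTheory GRing.Theory Num.Theory.
Import numFieldNormedType.Exports.

Local Open Scope ring_scope.

(** * Scores along a growing word *)

Definition pairs (a b : coin) (s : seq coin) : nat :=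
  (\sum_(i < (size s).-1) ((nth tails s i == a) && (nth tails s i.+1 == b)))%N.

Lemma score_pairs (n : nat) (a b : coin) (w : n.-tuple coin) :
  score a b w = pairs a b w.
Proof.
by rewrite /score /pairs size_tuple -sum1_card big_mkcond; apply: eq_bigr.
Qed.

(** Both scored patterns start with heads, so a new letter scores only after heads. The default
    [tails] of [last] makes the first letter of a word score nothing. *)
Lemma pairs_rcons (b c : coin) (s : seq coin) :
  pairs heads b (rcons s c) =
  (pairs heads b s + (last tails s && (c == b)))%N.
Proof.
case/lastP: s => [|s d]; first by rewrite /pairs !big_ord0.
rewrite /pairs !size_rcons /= big_ord_recr /= last_rcons; congr (_ + _)%N.
  apply: eq_bigr => i _; rewrite !(nth_rcons _ (rcons s d)) size_rcons.
  by rewrite !ltnS (ltnW (ltn_ord i)) ltn_ord.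
rewrite !nth_rcons size_rcons ltnSn eqxx ltnn ltnn eqxx.
by rewrite /heads eqb_id.
Qed.

Lemma pairs_le (a b : coin) (s : seq coin) : (pairs a b s <= size s)%N.
Proof.
apply: leq_trans (leq_pred _); rewrite /pairs.
rewrite -[leqRHS]card_ord -[leqRHS]sum1_card.
by apply: leq_sum => i _; exact: leq_b1.
Qed.

Lemma sum_tuple_rcons (V : nmodType) (n : nat) (f : seq coin -> V) :
  \sum_(w : n.+1.-tuple coin) f w =
  \sum_(w : n.-tuple coin) (f (rcons w heads) + f (rcons w tails)).
Proof.
pose h (p : n.-tuple coin * coin) := [tuple of rcons p.1 p.2].
have h_inj : injective h.
  move=> [v c] [w d] /(congr1 val) /= /rcons_inj [vw ->].
  by congr (_, _); exact: val_inj.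
rewrite (reindex h) /=; last first.
  apply: onW_bij; apply: inj_card_bij h_inj _.
  by rewrite card_prod !card_tuple card_bool expnSr.
rewrite -(pair_big predT predT (fun (w : n.-tuple coin) c => f (rcons w c))) /=.
by apply: eq_bigr => w _; rewrite big_bool.
Qed.

Lemma sum_tuple0 (V : nmodType) (f : seq coin -> V) :
  \sum_(w : 0.-tuple coin) f w = f [::].
Proof.
by rewrite (big_pred1 [tuple]) // => w; apply/esym/eqP; exact: tuple0.
Qed.

(** * Counting words by last letter and both scores *)

Definition word_count (n : nat) (P : pred (seq coin)) : int :=
  \sum_(w : n.-tuple coin) (P w)%:R.

Definition ends (c : coin) (a b : nat) (s : seq coin) : bool :=
  [&& last tails s == c, pairs heads heads s == a & pairs heads tails s == b].

Lemma word_count_headsS (n a b : nat) :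
  word_count n.+1 (ends heads a b) =
  word_count n (ends tails a b)
  + (if a is a'.+1 then word_count n (ends heads a' b) else 0).
Proof.
rewrite /word_count (sum_tuple_rcons _ _ (fun s => (ends heads a b s)%:R)).
have -> : (if a is a'.+1 then \sum_(w : n.-tuple coin) (ends heads a' b w)%:R
           else 0) =
          \sum_(w : n.-tuple coin)
             (if a is a'.+1 then ends heads a' b w else false)%:R :> int.
  by case: a => [|a] //; rewrite big1.
rewrite -big_split; apply: eq_bigr => w _ /=.
rewrite /ends !pairs_rcons !last_rcons /heads /tails /= addr0 andbT andbF addn0.
case: (last _ _) => /=; last by rewrite addn0; case: a => [|a] /=; rewrite addr0.
by case: a => [|a] /=; rewrite addn1 ?eqSS ?add0r.
Qed.

Lemma word_count_tailsS (n a b : nat) :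
  word_count n.+1 (ends tails a b) =
  word_count n (ends tails a b)
  + (if b is b'.+1 then word_count n (ends heads a b') else 0).
Proof.
rewrite /word_count (sum_tuple_rcons _ _ (fun s => (ends tails a b s)%:R)).
have -> : (if b is b'.+1 then \sum_(w : n.-tuple coin) (ends heads a b' w)%:R
           else 0) =
          \sum_(w : n.-tuple coin)
             (if b is b'.+1 then ends heads a b' w else false)%:R :> int.
  by case: b => [|b] //; rewrite big1.
rewrite -big_split; apply: eq_bigr => w _ /=.
rewrite /ends !pairs_rcons !last_rcons /heads /tails /= add0r andbT andbF addn0.
case: (last _ _) => /=; last by rewrite addn0; case: b => [|b] /=; rewrite addr0.
by case: b => [|b] /=; rewrite addn1 ?andbF ?eqSS ?add0r.
Qed.

(* A word ending in heads with scores (a, b) has a + b + 1 heads in b + 1 runs,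
   the last of them at the end; a word ending in tails has a + b heads in b
   runs. Choose the composition of the heads and the gaps that hold the runs. *)
Lemma word_count_ends (n a b : nat) :
  word_count n (ends heads a b) =
    (if (a + b < n)%N then 'C(a + b, b) * 'C(n.-1 - (a + b), b) else 0)%N /\
  word_count n (ends tails a b) =
    (if (a + b <= n)%N then
       if b is b'.+1 then 'C(a + b', b') * 'C(n - (a + b), b) else nat_of_bool (a == 0)
     else 0)%N.
Proof.
elim: n a b => [|n IHn] a b.
  (* The empty word counts as ending in tails, with both scores 0. *)
  rewrite ltn0 /word_count (sum_tuple0 _ (fun s => (ends heads a b s)%:R)).
  rewrite (sum_tuple0 _ (fun s => (ends tails a b s)%:R)) /ends /= /pairs /= !big_ord0.
  by case: a b => [|a] [|b].
split.
  rewrite word_count_headsS (IHn a b).2 ltnS.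
  case: a => [|a]; last rewrite (IHn a b).1.
    by case: b => [|b]; rewrite ?add0n ?binn ?bin0 addr0.
  rewrite addSn -PoszD; congr Posz; case: ifP => // abn.
  case: b abn => [|b] abn; first by rewrite !bin0 muln1 add0n.
  by rewrite addSnnS binS mulnDl addnC -[n.-1]subn1 -subnDA add1n.
rewrite word_count_tailsS (IHn a b).2.
case: b => [|b]; last rewrite (IHn a b).1.
  by case: a => [|a]; rewrite addr0 //=; case: ifP; case: ifP.
rewrite -PoszD; congr Posz.
rewrite addnS ltnS subSS; case: (ltngtP (a + b)%N n) => abn; last 2 first.
- by [].
- by rewrite abn subnn muln0.
have -> : (n - (a + b) = (n - (a + b).+1).+1)%N by lia.
by rewrite binS mulnDr; congr (_ + _ * 'C(_, _)); lia.
Qed.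

Lemma word_count_partition (n : nat) (P : pred (seq coin)) (v : seq coin -> nat)
    (F : nat -> pred (seq coin)) :
  (forall s, (v s <= size s)%N) -> (forall a s, F a s = P s && (v s == a)) ->
  word_count n P = \sum_(a < n.+1) word_count n (F a).
Proof.
move=> v_le FE; rewrite /word_count exchange_big; apply: eq_bigr => w _ /=.
have vw : (v w < n.+1)%N by rewrite ltnS -[leqRHS](size_tuple w).
rewrite (bigD1 (Ordinal vw)) //= FE eqxx andbT big1 ?addr0 // => i.
by rewrite -val_eqE /= FE eq_sym => /negbTE ->; rewrite andbF.
Qed.

(** * The sum s n: leads of one point, ties and wins *)

Definition coin_sum (n : nat) : nat :=
  (\sum_(k < n.+1) 'C(k.*2, k) * 'C(n - k.*2, k))%N.

(** The terms with 3 k > n vanish, so [coin_sum n] and [coin_sum n.+1] can be compared over a common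
    range. *)
Lemma coin_sum_tail (m n : nat) : (n <= m)%N ->
  coin_sum n =
  (1 + \sum_(k < m) 'C(k.+1.*2, k.+1) * 'C(n - k.+1.*2, k.+1))%N.
Proof.
move=> nm; rewrite /coin_sum big_ord_recl /= !bin0; congr (_ + _)%N.
rewrite -!(big_mkord xpredT (fun k => 'C(k.+1.*2, k.+1) * 'C(n - k.+1.*2, k.+1))%N).
rewrite [in RHS](big_cat_nat (leq0n n) nm) /= [X in _ = (_ + X)%N]big_nat_cond.
rewrite [X in _ = (_ + X)%N]big1 ?addn0 // => i.
by rewrite andbT => /andP[ni _]; rewrite [X in (_ * X)%N]bin_small ?muln0 //; lia.
Qed.

(** Pascal's rule splits a central coefficient into two coefficients that are equal by symmetry.
    Scores that differ by one produce these halves. *)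
Lemma mul2_bin_central (k : nat) :
  (2 * 'C(k.*2.+1, k.+1) = 'C(k.+1.*2, k.+1))%N /\
  (2 * 'C(k.*2.+1, k) = 'C(k.+1.*2, k.+1))%N.
Proof.
have sub : (k <= k.*2.+1)%N by lia.
have sym : 'C(k.*2.+1, k.+1) = 'C(k.*2.+1, k).
  by rewrite -(bin_sub sub); congr binomial; lia.
by split; rewrite doubleS [RHS]binS sym addnn mul2n.
Qed.

(** Scores (k, k + 1) give half the term k + 1 of [coin_sum n]; the 1 subtracted is its term at
    0. *)
Lemma word_count_lead_one (n : nat) :
  2 * word_count n (fun s => (last tails s == heads) &&
         (pairs heads tails s == (pairs heads heads s).+1)) =
  (coin_sum n)%:Z - 1.
Proof.
rewrite (@word_count_partition _ _ (pairs heads heads)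
  (fun a => ends heads a a.+1)) => [|s|a s]; first last.
- rewrite /ends; case: (last _ _ == _) => //=.
  by case: (pairs _ _ s =P a) => [->|]; rewrite ?andbF ?andbT.
- exact: pairs_le.
rewrite (@coin_sum_tail n.+1) // PoszD addrC addKr (big_morph Posz PoszD erefl).
rewrite big_distrr; apply: eq_bigr => k _ /=.
rewrite (word_count_ends _ _ _).1 -PoszM; congr Posz.
rewrite -[(1 + 1)%N]/2%N addnS addnn -(mul2_bin_central k).1.
case: (ltnP k.*2.+1 n) => kn; first by rewrite mulnA; congr (_ * 'C(_, _))%N; lia.
by rewrite muln0 [X in (_ * X)%N]bin_small ?muln0 //; lia.
Qed.

(** For 2 k + 1 < n, scores (k + 1, k) are attained by 'C(2 k + 1, k) 'C(n - 2 k - 2, k) words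
    ending in heads. Doubled, this is by Pascal's rule the increment of the term k + 1 from
    [coin_sum n] to [coin_sum n.+1]. *)
Lemma word_count_trail_one (n : nat) :
  2 * word_count n (fun s => (last tails s == heads) &&
         (pairs heads heads s == (pairs heads tails s).+1)) =
  (coin_sum n.+1)%:Z - (coin_sum n)%:Z.
Proof.
rewrite (@word_count_partition _ _ (pairs heads tails)
  (fun b => ends heads b.+1 b)) => [|s|b s]; first last.
- rewrite /ends; case: (last _ _ == _) => //=.
  by case: (pairs _ tails s =P b) => [->|]; rewrite ?andbF ?andbT.
- exact: pairs_le.
rewrite !(@coin_sum_tail n.+1) // !PoszD !(big_morph Posz PoszD erefl).
rewrite opprD addrACA subrr add0r -sumrB.
rewrite big_distrr; apply: eq_bigr => k _ /=.
rewrite (word_count_ends _ _ _).1.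
apply/eqP; rewrite eq_sym subr_eq eq_sym; apply/eqP.
rewrite -PoszM -PoszD; congr Posz.
rewrite -[(1 + 1)%N]/2%N addSn addnn -(mul2_bin_central k).2.
case: (ltnP k.*2.+1 n) => kn.
  have -> : (n.+1 - k.+1.*2 = (n - k.+1.*2).+1)%N by lia.
  have -> : (n.-1 - k.*2.+1 = n - k.+1.*2)%N by lia.
  by rewrite binS mulnDr [LHS]addnC mulnA.
rewrite muln0 add0n.
by rewrite [X in (_ * X = _)%N]bin_small ?[X in (_ = _ * X)%N]bin_small //; lia.
Qed.

(** Tied words ending in heads match [coin_sum n] term by term; those ending in tails give half the
    terms k > 0 of [coin_sum n.+1], together with the word without heads. *)
Lemma word_count_tie (n : nat) :
  2 * word_count n.+1 (fun s => pairs heads heads s == pairs heads tails s) =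
  (coin_sum n.+1)%:Z + 1 + 2 * (coin_sum n)%:Z.
Proof.
rewrite (@word_count_partition _ _ (pairs heads tails)
  (fun b s => ends heads b b s || ends tails b b s)) => [|s|b s]; first last.
- rewrite /ends; case: (last _ _) => /=; rewrite ?orbF;
  by case: (pairs _ tails s =P b) => [->|]; rewrite ?andbF ?andbT.
- exact: pairs_le.
rewrite (eq_bigr (fun b : 'I__ => word_count n.+1 (ends heads b b) +
                                  word_count n.+1 (ends tails b b))); last first.
  move=> b _; rewrite /word_count -big_split; apply: eq_bigr => w _ /=.
  by rewrite /ends; case: (last _ _); rewrite ?orbF ?addr0 ?add0r.
rewrite big_split mulrDr addrC /=; congr (_ + 2 * _).
  rewrite big_ord_recl (word_count_ends _ _ _).2 /= mulrDr.
  rewrite (@coin_sum_tail n.+1 n.+1) // PoszD (big_morph Posz PoszD erefl).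
  (* The all-tails word is doubled to 2, while the term k = 0 of [coin_sum] is 1: hence the 1 added
     in the statement. *)
  set T := \sum_(k < n.+1) Posz _; transitivity (2 + T); last by lia.
  congr (_ + _); rewrite /T.
  rewrite big_distrr; apply: eq_bigr => k _ /=.
  rewrite (word_count_ends _ _ _).2 /bump /= add1n -PoszM; congr Posz.
  rewrite -[(1 + 1)%N]/2%N addnn addSn addnn -(mul2_bin_central k).2.
  case: ifP => kn; first by rewrite mulnA.
  by rewrite muln0 [X in (_ * X)%N]bin_small ?muln0 //; lia.
rewrite /coin_sum (big_morph Posz PoszD erefl) big_ord_recr /=.
rewrite [X in _ + X = _](_ : _ = 0) ?addr0; last first.
  by rewrite (word_count_ends _ _ _).1; case: ltnP => //; lia.
apply: eq_bigr => k _; rewrite (word_count_ends _ _ _).1 addnn.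
by case: ltnP => // kn; rewrite [X in (_ * X)%N]bin_small ?muln0 //; lia.
Qed.

Definition lead_sum (n : nat) : int :=
  \sum_(w : n.-tuple coin)
     ((pairs heads heads w < pairs heads tails w)%N%:R
      - (pairs heads tails w < pairs heads heads w)%N%:R).

(* After tails no score can change; after heads the two possible coins change the
   difference of the scores by -1 and +1, so that the signs of the two new
   differences add up to twice the old sign unless the old difference is -1 or 1. *)
Lemma lead_sumS (n : nat) :
  2 * lead_sum n.+1 =
  4 * lead_sum n + (coin_sum n.+1)%:Z - 2 * (coin_sum n)%:Z + 1.
Proof.
rewrite -addrA -addrA.
have -> : (coin_sum n.+1)%:Z + (- (2 * (coin_sum n)%:Z) + 1) =
    ((coin_sum n.+1)%:Z - (coin_sum n)%:Z) - ((coin_sum n)%:Z - 1) by ring.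
rewrite -word_count_lead_one -word_count_trail_one -mulrBr.
rewrite (_ : 4 = 2 * 2) // -mulrA -mulrDr; congr (2 * _).
pose f s : int := (pairs heads heads s < pairs heads tails s)%N%:R
      - (pairs heads tails s < pairs heads heads s)%N%:R.
rewrite /lead_sum (sum_tuple_rcons _ _ f) /word_count -sumrB mulr_sumr.
rewrite -big_split; apply: eq_bigr => w _ /=.
rewrite /f !pairs_rcons /heads /tails /= andbT andbF !addn0.
case: (last _ _) => /=; rewrite ?addn0 ?addn1; last by ring.
by rewrite !natz; lia.
Qed.

Lemma lead_sumE (n : nat) : 2 * lead_sum n = (coin_sum n)%:Z - 1.
Proof.
elim: n => [|n IHn]; last by rewrite lead_sumS; lia.
pose f s : int := (pairs heads heads s < pairs heads tails s)%N%:R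
      - (pairs heads tails s < pairs heads heads s)%N%:R.
by rewrite /lead_sum (sum_tuple0 _ f) /f /pairs /coin_sum !big_ord_recl !big_ord0.
Qed.

(** * From counts of words to probabilities *)

Lemma flips_prob_card (R : realType) (n : nat) (E : {set n.-tuple coin}) :
  flips_prob R E = #|E|%:R / 2 ^+ n.
Proof.
rewrite /flips_prob (eq_bigr (fun _ => (2 ^+ n)^-1)) => [|w _].
  by rewrite sumr_const mulr_natl.
rewrite (eq_bigr (fun _ => 2^-1)) => [|i _].
  by rewrite prodr_const card_ord exprVn.
by rewrite /bernoulli_pmf; case: (tnth w i) => //; field.
Qed.

Lemma card_word_count (n : nat) (P : pred (seq coin)) (E : {set n.-tuple coin}) :
  (forall w : n.-tuple coin, (w \in E) = P w) -> #|E|%:Z = word_count n P.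
Proof.
move=> EP; rewrite -sum1_card (big_morph Posz PoszD erefl) big_mkcond /=.
by apply: eq_bigr => w _; rewrite EP natz; case: (P w).
Qed.

Lemma lead_prob (R : realType) (n : nat) :
  flips_prob R (bob_wins n) - flips_prob R (alice_wins n) =
  ((coin_sum n)%:R - 1) / 2 / 2 ^+ n.
Proof.
have cards : #|bob_wins n|%:Z - #|alice_wins n|%:Z = lead_sum n.
  rewrite (@card_word_count _
    (fun s => (pairs heads heads s < pairs heads tails s)%N)) => [|w].
    rewrite (@card_word_count _
      (fun s => (pairs heads tails s < pairs heads heads s)%N)) => [|w].
      by rewrite /word_count /lead_sum sumrB.
    by rewrite inE /alice_score /bob_score !score_pairs.
  by rewrite inE /alice_score /bob_score !score_pairs.
have := lead_sumE n; rewrite -cards => /(congr1 (fun z : int => z%:~R : R)).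
rewrite intrM !intrB /= => E; rewrite !flips_prob_card -mulrBl; congr (_ / _).
by move: E; rewrite -!pmulrn (_ : (1 + 1)%:R = 2) //; lra.
Qed.

Lemma tie_prob (R : realType) (n : nat) :
  flips_prob R (tie n.+1) =
  ((coin_sum n.+1)%:R + 1 + 2 * (coin_sum n)%:R) / 2 / 2 ^+ n.+1.
Proof.
have := word_count_tie n; rewrite -(@card_word_count _ _ (tie n.+1)); last first.
  by move=> w; rewrite inE /alice_score /bob_score !score_pairs.
move=> /(congr1 (fun z : int => z%:~R : R)); rewrite !intrD !intrM /= => E.
rewrite flips_prob_card; congr (_ / _).
by move: E; rewrite -!pmulrn (_ : (1 + 1)%:R = 2) //; lra.
Qed.

(** Besides the term 1 at k = 0 there is the term 2 (n - 2) at k = 1. *)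
Lemma coin_sum_ge (n : nat) : (3 <= n)%N -> (1 < coin_sum n)%N.
Proof.
move=> n3; rewrite (@coin_sum_tail n) //; case: n n3 => [|n] // n3.
by rewrite big_ord_recl /= !bin1; lia.
Qed.

(** * Moments of the walk with steps 1 and 3 *)

Section Weights.
Context {R : realType}.

(* The probability that a walk on nat with steps 1 and 3, each of probability
   1/2, visits n after exactly k steps of length 3: there are n - 3 k steps of
   length 1, and 'C(n - 2 k, k) 2 ^- (n - 2 k) = 'C(n - 2 k, k) 4 ^ k / 2 ^ n. *)
Definition weight (n k : nat) : R := 'C(n - k.*2, k)%:R * 4 ^+ k / 2 ^+ n.

(** Not normalised: the expectation is restricted to the event that the walk visits n, whose
    probability is [mass n]. *)
Definition expect (n : nat) (g : nat -> R) : R :=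
  \sum_(k < n.+1) weight n k * g k.

Lemma weight_ge0 (n k : nat) : 0 <= weight n k.
Proof. by rewrite /weight !mulr_ge0 // ?invr_ge0 ?exprn_ge0. Qed.

Lemma weight0 (n : nat) : weight n 0 = 2 ^- n.
Proof. by rewrite /weight bin0 expr0 !mul1r. Qed.

Lemma weight_eq0 (n k : nat) : (n < k)%N -> weight n k = 0.
Proof. by move=> nk; rewrite /weight bin_small ?mul0r //; lia. Qed.

(** Condition on the last step: Pascal's rule separates a short step from n + 2 and a long step from
    n. *)
Lemma weightS (n k : nat) :
  weight n.+3 k.+1 = (weight n.+2 k.+1 + weight n k) / 2.
Proof.
have E : 'C(n.+3 - k.+1.*2, k.+1) =
    ('C(n.+2 - k.+1.*2, k.+1) + 'C(n - k.*2, k))%N.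
  have [kn|nk] := leqP k.*2 n; last by rewrite !bin_small //; lia.
  have -> : (n.+3 - k.+1.*2 = (n - k.*2).+1)%N by lia.
  by rewrite binS.
rewrite /weight E natrD !exprS; field.
by rewrite expf_neq0 // pnatr_eq0.
Qed.

Lemma expect_widen (m n : nat) (g : nat -> R) : (n < m)%N ->
  \sum_(k < m) weight n k * g k = expect n g.
Proof.
move=> nm; rewrite /expect -!(big_mkord xpredT (fun k => weight n k * g k)).
rewrite (big_cat_nat (leq0n n.+1) nm) /= [X in _ + X]big_nat_cond.
rewrite [X in _ + X]big1 ?addr0 // => i.
by rewrite andbT => /andP[ni _]; rewrite weight_eq0 ?mul0r.
Qed.

Lemma expectS (n : nat) (g : nat -> R) :
  expect n.+3 g = (expect n.+2 g + expect n (fun k => g k.+1)) / 2.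
Proof.
rewrite -(@expect_widen n.+4 n.+2) // -(@expect_widen n.+3 n) ?(leq_addl 2) //.
rewrite /expect [LHS]big_ord_recl.
rewrite [X in _ = (X + _) * _]big_ord_recl.
rewrite !weight0 /= -addrA -big_split /= mulrDl mulr_suml; congr (_ + _).
  by rewrite [in LHS]exprS invfM; ring.
by apply: eq_bigr => k _; rewrite weightS; ring.
Qed.

Lemma expectD (n : nat) (g h : nat -> R) :
  expect n (fun k => g k + h k) = expect n g + expect n h.
Proof. by rewrite -big_split; apply: eq_bigr => k _; rewrite mulrDr. Qed.

Lemma expectZ (n : nat) (c : R) (g : nat -> R) :
  expect n (fun k => c * g k) = c * expect n g.
Proof. by rewrite mulr_sumr; apply: eq_bigr => k _; rewrite mulrCA. Qed.

Lemma expect_le (n : nat) (g h : nat -> R) :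
  (forall k, g k <= h k) -> expect n g <= expect n h.
Proof.
by move=> gh; apply: ler_sum => k _; rewrite ler_wpM2l ?weight_ge0.
Qed.

Lemma eq_expect (n : nat) (g h : nat -> R) : g =1 h -> expect n g = expect n h.
Proof. by move=> gh; apply: eq_bigr => k _; rewrite gh. Qed.

Definition mass (n : nat) : R := expect n (fun=> 1).
(** The quantity 4 k - n moves by -1 at a short step and by +1 at a long one, whence the recurrences
    for its moments. *)
Definition drift (n : nat) : R := expect n (fun k => 4 * k%:R - n%:R).
Definition spread (n : nat) : R := expect n (fun k => (4 * k%:R - n%:R) ^+ 2).

Lemma massS (n : nat) : mass n.+3 = (mass n.+2 + mass n) / 2.
Proof. exact: expectS. Qed.

Lemma driftS (n : nat) :
  drift n.+3 = (drift n.+2 - mass n.+2 + drift n + mass n) / 2.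
Proof.
rewrite /drift /mass expectS -addrA; congr ((_ + _) / _).
  rewrite -[- expect _ _]mulN1r -expectZ -expectD; apply: eq_expect => k.
  by rewrite -(natr1 n.+2); ring.
by rewrite -expectD; apply: eq_expect => k; rewrite -natr1 -(addn3 n) natrD; ring.
Qed.

Lemma spreadS (n : nat) :
  spread n.+3 = (spread n.+2 - 2 * drift n.+2 + mass n.+2
                 + spread n + 2 * drift n + mass n) / 2.
Proof.
rewrite /spread /drift /mass expectS -addrA -!addrA [in RHS]addrA [in RHS]addrA.
congr ((_ + _) / _).
  rewrite -[- (2 * _)]mulNr -!expectZ -!expectD; apply: eq_expect => k.
  by rewrite -(natr1 n.+2); ring.
rewrite -!expectZ -!expectD; apply: eq_expect => k.
by rewrite -natr1 -(addn3 n) natrD; ring.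
Qed.

Lemma expect_small (g : nat -> R) :
  [/\ expect 0 g = g 0%N, expect 1 g = g 0%N / 2 & expect 2 g = g 0%N / 4].
Proof.
rewrite /expect !big_ord_recr !big_ord0 /= !weight0 /weight /=.
by rewrite !bin0n /= expr0 expr1; split; field.
Qed.

Lemma mass_init : [/\ mass 0 = 1, mass 1 = 1 / 2 & mass 2 = 1 / 4].
Proof. by case: (expect_small (fun=> 1)). Qed.

Lemma drift_init : [/\ drift 0 = 0, drift 1 = - 1 / 2 & drift 2 = - 1 / 2].
Proof.
have init m := expect_small (fun k => 4 * k%:R - m%:R).
rewrite /drift (let: And3 e _ _ := init 0%N in e).
rewrite (let: And3 _ e _ := init 1%N in e) (let: And3 _ _ e := init 2%N in e).
by split; field.
Qed.

Lemma mass_bounds (n : nat) : 0 <= mass n <= 1.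
Proof.
suff [] : [/\ 0 <= mass n <= 1, 0 <= mass n.+1 <= 1 & 0 <= mass n.+2 <= 1] by [].
elim: n => [|n [m0 m1 m2]]; last by split=> //; rewrite massS; lra.
by case: mass_init => -> -> ->; split; lra.
Qed.

(** The recurrence has characteristic polynomial 2 x^3 - x^2 - 1 = (x - 1) (2 x^2 + x + 1). Dividing
    out x - 1 leaves a conserved quantity, which fixes the limit 1/2. *)
Lemma mass_sum (n : nat) : 2 * mass n.+2 + mass n.+1 + mass n = 2.
Proof.
elim: n => [|n IHn]; last by rewrite massS; lra.
by case: mass_init => -> -> ->; lra.
Qed.

Lemma drift_sum (n : nat) :
  2 * drift n.+2 + drift n.+1 + drift n = - (mass n + mass n.+1).
Proof.
elim: n => [|n IHn]; last by rewrite driftS; lra.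
by case: mass_init drift_init => -> -> _ [-> -> ->]; lra.
Qed.

(* Four steps of the recurrence 2 x (n+2) + x (n+1) + x n = 0 contract the sup norm
   by 1/2, and (7 / 8) ^+ 4 >= 1/2. *)
Lemma mass_close (n : nat) : `|mass n - 1 / 2| <= (7 / 8) ^+ n.
Proof.
suff [] : [/\ `|mass n - 1 / 2| <= (7 / 8) ^+ n,
  `|mass n.+1 - 1 / 2| <= (7 / 8) ^+ n.+1,
  `|mass n.+2 - 1 / 2| <= (7 / 8) ^+ n.+2 &
  `|mass n.+3 - 1 / 2| <= (7 / 8) ^+ n.+3] by [].
elim: n => [|n [m0 m1 m2 m3]].
  rewrite massS; case: mass_init => -> -> ->.
  by rewrite !ler_norml !exprS expr0; split; lra.
split=> //; move: m0 m1; rewrite !ler_norml !exprS.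
have s0 := mass_sum n; have s1 := mass_sum n.+1; have s2 := mass_sum n.+2.
have : 0 <= (7 / 8 : R) ^+ n by rewrite exprn_ge0 //; lra.
by move: (_ ^+ n) => r; lra.
Qed.

(** The contraction used for [mass_close] leaves at most 4 / 2, and the right-hand sides of
    [drift_sum], which lie in [-2, 0], add at most 1. *)
Lemma drift_le (n : nat) : `|drift n| <= 4.
Proof.
suff [] : [/\ `|drift n| <= 4, `|drift n.+1| <= 4, `|drift n.+2| <= 4 &
  `|drift n.+3| <= 4] by [].
elim: n => [|n [d0 d1 d2 d3]].
  rewrite driftS; case: mass_init drift_init => -> _ -> [-> -> ->].
  by rewrite !ler_norml; split; lra.
split=> //; move: d0 d1; rewrite !ler_norml.
have s0 := drift_sum n; have s1 := drift_sum n.+1; have s2 := drift_sum n.+2.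
have m0 := mass_bounds n; have m1 := mass_bounds n.+1.
have m2 := mass_bounds n.+2; have m3 := mass_bounds n.+3.
lra.
Qed.

(** By [spreadS], each value exceeds the average of two earlier ones by at most 9 = 2 * 4 + 1, as
    |drift| <= 4 and mass <= 1. *)
Lemma spread_le (n : nat) : spread n <= 9 * n%:R.
Proof.
suff [] : [/\ spread n <= 9 * n%:R, spread n.+1 <= 9 * n.+1%:R &
  spread n.+2 <= 9 * n.+2%:R] by [].
elim: n => [|n [q0 q1 q2]].
  have init m := expect_small (fun k => (4 * k%:R - m%:R) ^+ 2).
  rewrite /spread (let: And3 e _ _ := init 0%N in e).
  rewrite (let: And3 _ e _ := init 1%N in e) (let: And3 _ _ e := init 2%N in e).
  by split; lra.
split=> //; rewrite spreadS.
move: q0 q2 (drift_le n) (drift_le n.+2) (mass_bounds n) (mass_bounds n.+2).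
by rewrite !ler_norml -(addn3 n) -(addn2 n) !natrD; lra.
Qed.

End Weights.

(** * Wallis' inequalities for central binomial coefficients *)

Section Wallis.
Context {R : realType}.

(** Antiderivatives of the powers of sin, by the reduction formula that integration by parts
    yields. *)
Fixpoint sin_primitive (k : nat) (x : R) : R :=
  match k with
  | 0 => x
  | 1 => - cos x
  | (k'.+1 as k1).+1 =>
      (k1%:R * sin_primitive k' x - cos x * sin x ^+ k1) / k1.+1%:R
  end.

Lemma sin_primitiveSS (k : nat) (x : R) :
  sin_primitive k.+2 x =
  (k.+1%:R * sin_primitive k x - cos x * sin x ^+ k.+1) / k.+2%:R.
Proof. by []. Qed.

Lemma is_derive_sin_primitive (k : nat) (x : R) :
  is_derive x 1 (sin_primitive k) (sin x ^+ k).
Proof.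
suff [] : is_derive x 1 (sin_primitive k) (sin x ^+ k) /\
          is_derive x 1 (sin_primitive k.+1) (sin x ^+ k.+1) by [].
elim: k => [|k [IHk IHk1]].
  split; first by rewrite expr0; exact: (is_derive_id x 1).
  rewrite expr1; apply: (@is_derive_eq _ _ _ (- cos) _ _ _ _ _ (opprK _)).
split=> //.
have -> : sin_primitive k.+2 =
    k.+2%:R^-1 *: (k.+1%:R *: sin_primitive k - cos * sin ^+ k.+1).
  by apply/funext => y; rewrite sin_primitiveSS mulrC !fctE.
apply: is_derive_eq.
have c2 : cos x * cos x = 1 - sin x * sin x.
  by rewrite -(cos2Dsin2 x) !expr2 addrK.
rewrite /GRing.scale /= !fctE [cos x * _]mulrC -mulrA c2 -natr1 !exprS; field.
by rewrite nat1r natr1 pnatr_eq0.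
Qed.

(* The integral of sin ^+ k over [0, pi / 2]. *)
Definition wallis (k : nat) : R := sin_primitive k (pi / 2) - sin_primitive k 0.

Lemma wallis0 : wallis 0 = pi / 2.
Proof. by rewrite /wallis /= subr0. Qed.

Lemma wallis1 : wallis 1 = 1.
Proof. by rewrite /wallis /= cos_pihalf cos0 oppr0 opprK add0r. Qed.

Lemma wallisSS (k : nat) : wallis k.+2 = k.+1%:R / k.+2%:R * wallis k.
Proof.
rewrite /wallis !sin_primitiveSS cos_pihalf sin0 expr0n mul0r mulr0 !subr0.
by rewrite -mulrBl -mulrBr mulrAC.
Qed.

(** The difference of the primitives has derivative sin^k x (1 - sin x) >= 0 on [0, pi / 2]. *)
Lemma wallis_anti (k : nat) : wallis k.+1 <= wallis k.
Proof.
pose f : R -> R := sin_primitive k - sin_primitive k.+1.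
have df (x : R) : is_derive x 1 f (sin x ^+ k - sin x ^+ k.+1).
  by apply: is_deriveB; exact: is_derive_sin_primitive.
have h : f 0 <= f (pi / 2).
  apply: (@ger0_derive1_ndecr _ f 0 (pi / 2)) => //.
  - move=> x; rewrite in_itv /= => /andP[x0 xpi]; rewrite derive1E derive_val.
    have s0 : 0 <= sin x by apply: sin_ge0_pi; have := pi_gt0 R; lra.
    by rewrite exprS -{1}[sin x ^+ k]mul1r -mulrBl mulr_ge0 ?exprn_ge0 // subr_ge0 sin_le1.
  - by apply: derivable_within_continuous => x _.
  - by have := pi_gt0 R; lra.
by move: h; rewrite /f /wallis !fctE; lra.
Qed.

Definition central (k : nat) : R := 'C(k.*2, k)%:R / 4 ^+ k.

Lemma central_gt0 (k : nat) : 0 < central k.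
Proof. by rewrite divr_gt0 ?exprn_gt0 // ltr0n bin_gt0; lia. Qed.

Lemma centralS (k : nat) : central k.+1 = k.*2.+1%:R / k.*2.+2%:R * central k.
Proof.
have /(congr1 (GRing.natmul (1 : R))) :
  (k.+1 * 'C(k.+1.*2, k.+1) = 2 * (k.*2.+1 * 'C(k.*2, k)))%N.
  by rewrite -(mul2_bin_central k).1 mulnCA (mul_bin_diag k.*2.+1 k).
rewrite !natrM /central => E.
have k0 : k.+1%:R != 0 :> R by rewrite pnatr_eq0.
have -> : 'C(k.+1.*2, k.+1)%:R = 2 * (k.*2.+1%:R * 'C(k.*2, k)%:R) / k.+1%:R :> R.
  by rewrite -E mulrC mulKf.
rewrite -doubleS -[k.+1.*2]mul2n natrM exprS; move: k0; move: (k.+1%:R : R) => x x0.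
by field; rewrite x0 expf_neq0.
Qed.

Lemma wallis_central (k : nat) :
  wallis k.*2 = central k * (pi / 2) /\
  wallis k.*2.+1 = (k.*2.+1%:R * central k)^-1.
Proof.
elim: k => [|k [IHe IHo]].
  by rewrite /central /= bin0 expr0 wallis0 wallis1 !divr1 !mul1r invr1.
rewrite doubleS !wallisSS IHe IHo centralS; split; first by ring.
have := lt0r_neq0 (central_gt0 k); move: (central k) => c c0.
have nat0 m : m.+1%:R != 0 :> R by rewrite pnatr_eq0.
move: (nat0 k.*2) (nat0 k.*2.+1) (nat0 k.*2.+2).
move: (k.*2.+1%:R : R) (k.*2.+2%:R : R) (k.*2.+3%:R : R) => x y z x0 y0 z0.
by field; rewrite c0 x0 y0 z0.
Qed.

Lemma central_lower (k : nat) : 1 <= pi * central k ^+ 2 * (k%:R + 1 / 2).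
Proof.
have := wallis_anti k.*2; have [-> ->] := wallis_central k.
have c0 := central_gt0 k; rewrite -[X in X <= _]mul1r ler_pdivrMr; last first.
  by apply: mulr_gt0 => //; rewrite ltr0Sn.
by rewrite -(natr1 k.*2) -addnn natrD; lra.
Qed.

Lemma central_upper (k : nat) : pi * central k ^+ 2 * k%:R <= 1.
Proof.
case: k => [|k]; first by rewrite mulr0.
have := wallis_anti k.*2.+1; rewrite -doubleS (wallis_central k.+1).1.
have c0 := central_gt0 k.
rewrite (wallis_central k).2 -[X in _ <= X]mul1r ler_pdivlMr; last first.
  by apply: mulr_gt0 => //; rewrite ltr0Sn.
have -> : k.*2.+1%:R * central k = 2 * k.+1%:R * central k.+1.
  rewrite centralS -doubleS -[k.+1.*2]mul2n natrM; move: (pnatr_eq0 R k.+1).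
  by move: (k.+1%:R : R) => x /= /negbT x0; field.
by lra.
Qed.

End Wallis.

(** * Law of large numbers for the coin sum, and the two limits *)

Section Asymptotics.
Context {R : realType}.

Lemma expect_central (n : nat) :
  expect n central = (coin_sum n)%:R / 2 ^+ n :> R.
Proof.
rewrite /expect /coin_sum natr_sum mulr_suml; apply: eq_bigr => k _.
rewrite /weight /central natrM; field.
by rewrite !expf_neq0 ?pnatr_eq0.
Qed.

(* With c = 'C(2 k, k) / 4 ^ k this is t such that c = 1 / (sqrt pi * t), and
   Wallis' inequalities read k <= t ^ 2 <= k + 1 / 2. *)
Definition central_root (k : nat) : R := (Num.sqrt pi * central k)^-1.

Lemma central_root_gt0 (k : nat) : 0 < central_root k.
Proof. by rewrite invr_gt0 mulr_gt0 ?sqrtr_gt0 ?pi_gt0 ?central_gt0. Qed.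

Lemma central_root_sqr (k : nat) : k%:R <= central_root k ^+ 2 <= k%:R + 1 / 2.
Proof.
have p0 := pi_gt0 R; have c0 := @central_gt0 R k.
have pc0 : 0 < pi * central k ^+ 2 :> R by apply: mulr_gt0 => //; apply: exprn_gt0.
rewrite /central_root exprVn exprMn sqr_sqrtr ?(ltW p0) // -[_^-1]mul1r.
rewrite ler_pdivlMr // ler_pdivrMr // mulrC central_upper /=.
by rewrite mulrC central_lower.
Qed.

Lemma central_root_ge (k : nat) : 1 / 2 <= central_root k.
Proof.
suff s : 1 / 4 <= central_root k ^+ 2.
  by have := central_root_gt0 k; nra.
case: k => [|k]; last first.
  have /andP[+ _] := central_root_sqr k.+1; apply: le_trans.
  by rewrite -(natr1 k); have := ler0n R k; lra.
rewrite /central_root /central bin0 expr0 divr1 mulr1 exprVn sqr_sqrtr ?pi_ge0 //.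
by rewrite -[pi^-1]mul1r ler_pdivlMr ?pi_gt0 //; have := pihalf_lt2 R; lra.
Qed.

(** As a function of t^2, 1 / t is convex, so it lies above its tangent at b^2; t >= 1/2 controls
    the quadratic error near t = 0. *)
Lemma inv_tangent (b t : R) : 0 < b -> 1 / 2 <= t ->
  b^-1 - (t ^+ 2 - b ^+ 2) / (2 * b ^+ 3) <= t^-1
  <= b^-1 - (t ^+ 2 - b ^+ 2) / (2 * b ^+ 3)
     + 2 * (t ^+ 2 - b ^+ 2) ^+ 2 / b ^+ 4.
Proof.
move=> b0 t2; have t0 : 0 < t by lra.
have E : t^-1 - (b^-1 - (t ^+ 2 - b ^+ 2) / (2 * b ^+ 3)) =
    (b - t) ^+ 2 * (2 * b + t) / (2 * b ^+ 3 * t).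
  by field; rewrite !gt_eqF.
have den0 : 0 < 2 * b ^+ 3 * t by rewrite !mulr_gt0 ?exprn_gt0.
apply/andP; split.
  rewrite -subr_ge0 E; apply: divr_ge0; last exact: ltW.
  by rewrite mulr_ge0 ?sqr_ge0 //; lra.
rewrite addrC -lerBlDr E -subr_ge0.
have -> : 2 * (t ^+ 2 - b ^+ 2) ^+ 2 / b ^+ 4 -
    (b - t) ^+ 2 * (2 * b + t) / (2 * b ^+ 3 * t) =
    (b - t) ^+ 2 * (4 * t * (b + t) ^+ 2 - b * (2 * b + t)) / (2 * b ^+ 4 * t).
  by field; rewrite !gt_eqF.
apply: divr_ge0; last by rewrite !mulr_ge0 ?exprn_ge0 // ltW.
apply: mulr_ge0; first exact: sqr_ge0.
(* The constant 2 of the error term yields the coefficient 4 t - 2, nonnegative for t >= 1/2. *)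
have -> : 4 * t * (b + t) ^+ 2 - b * (2 * b + t) =
    (4 * t - 2) * (b + t) ^+ 2 + 3 * (b * t) + 2 * t ^+ 2 by ring.
have bt : 0 < b * t by exact: mulr_gt0.
have : 0 <= (4 * t - 2) * (b + t) ^+ 2 by apply: mulr_ge0 (sqr_ge0 _); lra.
by have := sqr_ge0 t; lra.
Qed.

Definition deviation (n k : nat) : R := central_root k ^+ 2 - n%:R / 4.

(** Single deviations may be of order sqrt n, but their mean stays bounded because [drift] does. *)
Lemma expect_deviation (n : nat) : - 1 <= expect n (deviation n) <= 3 / 2.
Proof.
have lo k : 1 / 4 * (4 * k%:R - n%:R) <= deviation n k.
  by rewrite /deviation; have := central_root_sqr k; lra.
have hi k : deviation n k <= 1 / 4 * (4 * k%:R - n%:R) + 1 / 2 * 1.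
  by rewrite /deviation; have := central_root_sqr k; lra.
have : expect n (deviation n) <= 1 / 4 * drift n + 1 / 2 * mass n.
  by rewrite -!expectZ -expectD; exact: expect_le.
have : 1 / 4 * drift n <= expect n (deviation n).
  by rewrite -expectZ; exact: expect_le.
have := @drift_le R n; have := @mass_bounds R n; rewrite ler_norml; lra.
Qed.

Lemma expect_deviation_sqr (n : nat) : (0 < n)%N ->
  expect n (fun k => deviation n k ^+ 2) <= 2 * n%:R.
Proof.
move=> n0.
have hi k : deviation n k ^+ 2 <= 1 / 8 * (4 * k%:R - n%:R) ^+ 2 + 1 / 2 * 1.
  rewrite /deviation; have := central_root_sqr k; move: (_ ^+ 2) => x /andP[xk kx].
  (* With a = (4 k - n) / 4 and e = x - k in [0, 1/2], the bound is (a + e)^2 <= 2 a^2 + 2 e^2. *)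
  have := sqr_ge0 ((4 * k%:R - n%:R) / 4 - (x - k%:R)).
  have : 0 <= (x - k%:R) * (1 / 2 - (x - k%:R)) by apply: mulr_ge0; lra.
  by nra.
have : expect n (fun k => deviation n k ^+ 2) <=
    1 / 8 * spread n + 1 / 2 * mass n.
  by rewrite -!expectZ -expectD; exact: expect_le.
have := @spread_le R n; have := @mass_bounds R n.
by have : 1 <= n%:R :> R; [rewrite ler1n|lra].
Qed.

(** Apply [inv_tangent] with b^2 = n / 4 and average over k. The constant gives the main term, the
    linear term is at most 6 / n by the bounded mean deviation, and the quadratic one at most 64 /
    n. *)
Lemma coin_sum_estimate (n : nat) : (0 < n)%N ->
  `|Num.sqrt pi * ((coin_sum n)%:R / 2 ^+ n) - 2 * @mass R n / Num.sqrt n%:R|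
    <= 70 / n%:R.
Proof.
move=> n0; have nR : 1 <= n%:R :> R by rewrite ler1n.
set r : R := Num.sqrt n%:R; have rn : r ^+ 2 = n%:R by rewrite sqr_sqrtr.
have r1 : 1 <= r by rewrite -sqrtr1 ler_sqrt // ?ltr0n.
have r0 : 0 < r by lra.
have b0 : 0 < r / 2 by lra.
have tan k := inv_tangent _ _ b0 (central_root_ge k).
have inv k : (central_root k)^-1 = Num.sqrt pi * central k by rewrite invrK.
have lo k : (r / 2)^-1 * 1 + (- (2 * (r / 2) ^+ 3)^-1) * deviation n k <=
            Num.sqrt pi * central k.
  have /andP[+ _] := tan k; rewrite inv; apply: le_trans.
  by rewrite le_eqVlt; apply/orP; left; apply/eqP; rewrite /deviation -rn; field; lra.
have hi k : Num.sqrt pi * central k <=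
    ((r / 2)^-1 * 1 + (- (2 * (r / 2) ^+ 3)^-1) * deviation n k) +
    (2 / (r / 2) ^+ 4) * deviation n k ^+ 2.
  have /andP[_ +] := tan k; rewrite inv => /le_trans; apply.
  by rewrite le_eqVlt; apply/orP; left; apply/eqP; rewrite /deviation -rn; field; lra.
have := @expect_deviation n; have := @expect_deviation_sqr n n0.
have : Num.sqrt pi * expect n (@central R) <=
    ((r / 2)^-1 * @mass R n + (- (2 * (r / 2) ^+ 3)^-1) * expect n (deviation n)) +
    (2 / (r / 2) ^+ 4) * expect n (fun k => deviation n k ^+ 2).
  by rewrite -!expectZ -!expectD; exact: expect_le.
have : (r / 2)^-1 * @mass R n + (- (2 * (r / 2) ^+ 3)^-1) * expect n (deviation n)
    <= Num.sqrt pi * expect n (@central R).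
  by rewrite -!expectZ -expectD; exact: expect_le.
rewrite expect_central -rn.
move: (expect _ _) (expect _ _) (Num.sqrt pi * _) => q d s lw up q_le d_le.
have r_n0 : r != 0 by rewrite gt_eqF.
have i0 : 0 < r^-1 by rewrite invr_gt0.
have i1 : r^-1 <= 1 by rewrite invf_le1.
have e1 : (r / 2)^-1 = 2 * r^-1 by field.
have e3 : (2 * (r / 2) ^+ 3)^-1 = 4 * (r^-1 ^+ 2 * r^-1) by field.
have e4 : 2 / (r / 2) ^+ 4 * q = 32 * (r^-1 ^+ 2 * (q * r^-1 ^+ 2)) by field.
have qi : q * r^-1 ^+ 2 <= 2 by rewrite exprVn ler_pdivrMr ?exprn_gt0.
move: lw up; rewrite e1 e3 e4 -exprVn ler_norml.
have i2 : 0 < r^-1 ^+ 2 by exact: exprn_gt0.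
have : r^-1 ^+ 2 * (q * r^-1 ^+ 2) <= r^-1 ^+ 2 * 2 by rewrite ler_pM2l.
have : r^-1 ^+ 2 * r^-1 <= r^-1 ^+ 2 by rewrite ler_piMr // ltW.
have i3 : 0 < r^-1 ^+ 2 * r^-1 by exact: mulr_gt0.
have : r^-1 ^+ 2 * r^-1 * d <= r^-1 ^+ 2 * r^-1 * (3 / 2).
  by rewrite ler_pM2l //; lra.
have : r^-1 ^+ 2 * r^-1 * -1 <= r^-1 ^+ 2 * r^-1 * d.
  by rewrite ler_pM2l //; lra.
lra.
Qed.

Lemma coin_sum_close (n : nat) :
  `|Num.sqrt pi * Num.sqrt n.+1%:R * ((coin_sum n.+1)%:R / 2 ^+ n.+1) - 1|
    <= 70 / Num.sqrt n.+1%:R + 2 * (7 / 8 : R) ^+ n.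
Proof.
have := coin_sum_estimate n.+1 isT; have := @mass_close R n.+1.
have nR : 1 <= n.+1%:R :> R by rewrite ler1n.
set r : R := Num.sqrt n.+1%:R; have <- : r ^+ 2 = n.+1%:R by rewrite sqr_sqrtr.
have r1 : 1 <= r by rewrite -sqrtr1 ler_sqrt // ?ltr0n.
have r0 : 0 < r by lra.
have p : 0 <= (7 / 8 : R) ^+ n by apply: exprn_ge0; lra.
move: (mass _) ((coin_sum _)%:R / _) => m s; rewrite exprS => mle est.
have : `|r * (Num.sqrt pi * s) - 2 * m| <= 70 / r.
  have -> : r * (Num.sqrt pi * s) - 2 * m = r * (Num.sqrt pi * s - 2 * m / r).
    by field; rewrite gt_eqF.
  rewrite normrM (gtr0_norm r0).
  have -> : 70 / r = r * (70 / r ^+ 2) by field; rewrite gt_eqF.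
  by rewrite ler_pM2l.
move: mle; rewrite mulrCA mulrA !ler_norml; lra.
Qed.

Lemma sqrt_pi_le2 : Num.sqrt pi <= 2 :> R.
Proof.
have -> : 2 = Num.sqrt (2 ^+ 2) :> R by rewrite sqrtr_sqr normr_nat.
by rewrite ler_sqrt; have := pihalf_lt2 R; lra.
Qed.

Lemma sqrt_div_exp2 (n : nat) :
  0 <= Num.sqrt (n.+1%:R : R) / 2 ^+ n.+1 <= (Num.sqrt n.+1%:R)^-1.
Proof.
have r0 : 0 < Num.sqrt n.+1%:R :> R by rewrite sqrtr_gt0 ltr0n.
have e0 : 0 < 2 ^+ n.+1 :> R by exact: exprn_gt0.
apply/andP; split; first by rewrite divr_ge0 // ltW.
rewrite ler_pdivrMr // mulrC ler_pdivlMr // -expr2 sqr_sqrtr //.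
by rewrite -natrX ler_nat ltnW // ltn_expl.
Qed.

Lemma cvg_rate (c d : R) (u : nat -> R) (l : R) :
  (forall n, `|u n - l| <= c / Num.sqrt n.+1%:R + d * (7 / 8) ^+ n) ->
  (u @ \oo --> l)%classic.
Proof.
move=> ule.
have sqrt_cvg : ((fun n => c / Num.sqrt n.+1%:R) @ \oo --> (0 : R))%classic.
  rewrite -(mulr0 c); apply: cvgMl_tmp.
  rewrite -[X in (_ --> X)%classic](@sqrtr0 R).
  under eq_fun do rewrite -sqrtrV //.
  by apply: continuous_cvg cvg_harmonic; exact: sqrt_continuous.
have geo_cvg : ((fun n => d * (7 / 8) ^+ n) @ \oo --> (0 : R))%classic.
  by apply: cvg_geometric; rewrite ger0_norm; lra.
pose e n : R := c / Num.sqrt n.+1%:R + d * (7 / 8) ^+ n.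
have e_cvg : (e @ \oo --> (0 : R))%classic.
  by rewrite -[0 : R]addr0; exact: (cvgD sqrt_cvg geo_cvg).
apply: (@squeeze_cvgr _ _ _ _ (fun n => l - e n) (fun n => l + e n)).
- by near=> n; have := ule n; rewrite ler_norml /e; lra.
- by rewrite -{2}[l]subr0; exact: (cvgB (cvg_cst l) e_cvg).
- by rewrite -{2}[l]addr0; exact: (cvgD (cvg_cst l) e_cvg).
Unshelve. all: end_near. Qed.

Lemma lead_asymp :
  asymp (fun n => flips_prob R (bob_wins n) - flips_prob R (alice_wins n))
        (fun n => (1 / (2 * Num.sqrt pi)) / Num.sqrt n%:R).
Proof.
(* The shift avoids division by sqrt 0. The rate is 70 from [coin_sum_close] plus 2 for the 1
   subtracted from [coin_sum]. *)
rewrite /asymp -cvg_shiftS; apply: (@cvg_rate 72 2) => n.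
rewrite /= lead_prob.
have p0 : 0 < Num.sqrt pi :> R by rewrite sqrtr_gt0 pi_gt0.
have r0 : 0 < Num.sqrt n.+1%:R :> R by rewrite sqrtr_gt0 ltr0n.
have := coin_sum_close n; have := sqrt_div_exp2 n; have := sqrt_pi_le2.
move: p0 r0; move: (Num.sqrt pi) (Num.sqrt n.+1%:R) => p r p0 r0 p2.
have e0 : 2 ^+ n.+1 != 0 :> R by rewrite expf_neq0.
move: e0; move: (2 ^+ n.+1) => e e0 re close.
have -> : ((coin_sum n.+1)%:R - 1) / 2 / e / (1 / (2 * p) / r) - 1 =
    (p * r * ((coin_sum n.+1)%:R / e) - 1) - p * (r / e).
  by field; rewrite e0 !gt_eqF.
have : 0 <= p * (r / e) <= 2 * r^-1.
  by have /andP[re0 re1] := re; rewrite mulr_ge0 ?(ltW p0) //= ler_pM // ltW.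
move: close; rewrite !ler_norml; lra.
Qed.

Lemma tie_asymp :
  asymp (fun n => flips_prob R (tie n)) (fun n => 1 / Num.sqrt (pi * n%:R)).
Proof.
(* Ties involve two consecutive values of [coin_sum], both wanted at positive indices: hence two
   shifts. The errors add up to (70 + 70 + 73 + 2) / 2 <= 110. *)
rewrite /asymp -cvg_shiftS -cvg_shiftS; apply: (@cvg_rate 110 2) => n.
rewrite /= tie_prob sqrtrM ?pi_ge0 //.
have := coin_sum_close n; have := coin_sum_close n.+1.
have := sqrt_div_exp2 n.+1; have := sqrt_pi_le2.
have p0 : 0 < Num.sqrt pi :> R by rewrite sqrtr_gt0 pi_gt0.
have r1_ge1 : 1 <= Num.sqrt n.+1%:R :> R.
  have nR : 1 <= n.+1%:R :> R by rewrite ler1n.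
  by rewrite -[leLHS]sqrtr1 ler_wsqrtr.
have r12 : Num.sqrt n.+1%:R <= Num.sqrt n.+2%:R :> R.
  by apply: ler_wsqrtr; rewrite ler_nat.
have r21 : Num.sqrt n.+2%:R <= Num.sqrt n.+1%:R + 1 :> R.
  rewrite -(@ler_pXn2r _ 2) ?nnegrE ?addr_ge0 ?sqrtr_ge0 // sqrrD.
  by rewrite !sqr_sqrtr // -(natr1 n.+1); lra.
have s1_ge0 : 0 <= (coin_sum n.+1)%:R / 2 ^+ n.+1 :> R.
  by rewrite divr_ge0 // exprn_ge0.
have q0 : 0 <= (7 / 8 : R) ^+ n by apply: exprn_ge0; lra.
have q1 : (7 / 8 : R) ^+ n <= 1 by apply: exprn_ile1; lra.
have -> : ((coin_sum n.+2)%:R + 1 + 2 * (coin_sum n.+1)%:R) / 2 / 2 ^+ n.+2 =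
    (coin_sum n.+2)%:R / 2 ^+ n.+2 / 2 + 1 / 2 / 2 ^+ n.+2
    + (coin_sum n.+1)%:R / 2 ^+ n.+1 / 2 :> R.
  by rewrite (exprS _ n.+1); field; rewrite expf_neq0.
have e0 : 2 ^+ n.+2 != 0 :> R by rewrite expf_neq0.
rewrite (exprS (7 / 8) n); move: r1_ge1 r12 r21 s1_ge0 q0 q1 e0 p0.
move: ((coin_sum n.+1)%:R / 2 ^+ n.+1) ((coin_sum n.+2)%:R / 2 ^+ n.+2) => s1 s2.
move: (2 ^+ n.+2) ((7 / 8) ^+ n) => e q.
move: (Num.sqrt pi) (Num.sqrt n.+1%:R) (Num.sqrt n.+2%:R) => p r1 r2.
move=> r1_ge1 r12 r21 s1_ge0 q0 q1 e0 p0 p2 re close2 close1.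
(* Each of s1 and s2 contributes half of the limit; r2 - r1 corrects the scaling of s1. *)
have -> : (s2 / 2 + 1 / 2 / e + s1 / 2) / (1 / (p * r2)) - 1 =
    ((p * r2 * s2 - 1) + (p * r1 * s1 - 1) + (r2 - r1) * (p * s1)
     + p * (r2 / e)) / 2.
  by field; rewrite e0 !gt_eqF //; lra.
have r1_gt0 : 0 < r1 by lra.
have r2_gt0 : 0 < r2 by lra.
have r12V : r2^-1 <= r1^-1 by rewrite lef_pV2.
have r1V : r1^-1 <= 1 by rewrite invf_le1.
have : 0 <= p * (r2 / e) <= 2 * r2^-1.
  by have /andP[re0 re1] := re; rewrite mulr_ge0 ?(ltW p0) //= ler_pM // ltW.
move: close1 close2; rewrite !ler_norml => close1 close2 pre.
(* From p r1 s1 <= 1 + 70 / r1 + 2 q <= 73. *)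
have ps : p * s1 <= 73 * r1^-1.
  by rewrite ler_pdivlMr // mulrAC; lra.
have : 0 <= (r2 - r1) * (p * s1) <= 1 * (73 * r1^-1).
  have ps0 : 0 <= p * s1 by rewrite mulr_ge0 // ltW.
  apply/andP; split; first by apply: mulr_ge0 => //; lra.
  by apply: ler_pM => //; lra.
lra.
Qed.

End Asymptotics.

Theorem theorem2 (R : realType) :
  (forall n : nat, (3 <= n)%N ->
     flips_prob R (alice_wins n) < flips_prob R (bob_wins n)) /\
  asymp (fun n : nat => flips_prob R (bob_wins n) - flips_prob R (alice_wins n))
        (fun n : nat => (1 / (2 * Num.sqrt pi)) / Num.sqrt n%:R) /\
  asymp (fun n : nat => flips_prob R (tie n))
        (fun n : nat => 1 / Num.sqrt (pi * n%:R)).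
Proof.
split; last by split; [exact: lead_asymp|exact: tie_asymp].
move=> n n3; rewrite -subr_gt0 lead_prob !divr_gt0 ?exprn_gt0 // subr_gt0.
by rewrite ltr1n coin_sum_ge.
Qed.
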